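(* Let $P>Q$ be integers, let $\alpha\in\mathbb{C}$, and let $\tau:\mathbb{Z}\to\mathbb{C}\setminus\{0\}$. Set $$v_m=\frac{\tau_m}{\tau_{m+Q}}\qquad(m\in\mathbb{Z}).$$ If $v$ satisfies, for all $m\in\mathbb{Z}$, $$\frac{v_m}{v_{m+P}}-\frac{v_{m-P}}{v_m}+\alpha\left(\frac{v_{m+P-Q}}{v_m}-\frac{v_m}{v_{m+Q-P}}\right)=0,$$ then there is a sequence $(\beta_m)_{m\in\mathbb{Z}}$ with $\beta_{m+Q}=\beta_m$ such that, for all $m\in\mathbb{Z}$, $$\tau_{m+2P}\,\tau_m=\alpha\,\tau_{m+2P-Q}\,\tau_{m+Q}+\beta_m\,\tau_{m+P}^2 .$$ Conversely, if $\tau$ satisfies the latter bilinear equation for all $m$ with some coefficient sequence satisfying $\beta_{m+Q}=\beta_m$, then $v$ satisfies the former equation for all $m$.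
   Context: All sequences are complex-valued and indexed by $\mathbb{Z}$. *)

(* Defs.v *)
From Stdlib Require Export Reals ZArith.
From Coquelicot Require Export Coquelicot.

(* Main.v *)
(** Solve the bilinear equation for its coefficient,
    [b m = (tau (m+2P) tau m - alpha tau (m+2P-Q) tau (m+Q)) / tau (m+P)^2].
    The left-hand side of the equation for [v] at [m] is a nonzero multiple of
    [b (m-P+Q) - b (m-P)], so it vanishes for all [m] exactly when [b] has
    period [Q]. *)

Require Import Defs.
From Stdlib Require Import Reals ZArith.
From Coquelicot Require Import Coquelicot.
From Stdlib Require Import Lia.
Open Scope C_scope.

Definition bilinear_coeff (P Q : Z) (alpha : C) (tau : Z -> C) (m : Z) : C :=
  (tau (m + 2 * P)%Z * tau m - alpha * tau (m + 2 * P - Q)%Z * tau (m + Q)%Z)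
    / tau (m + P)%Z ^ 2.

(** Read right to left this yields a coefficient sequence; read left to right it shows that no other
    one is possible. *)
Lemma bilinear_iff_coeff (P Q : Z) (alpha : C) (tau : Z -> C) (beta : C) (m : Z) :
  tau (m + P)%Z <> 0 ->
  tau (m + 2 * P)%Z * tau m =
    alpha * tau (m + 2 * P - Q)%Z * tau (m + Q)%Z + beta * tau (m + P)%Z ^ 2
  <-> beta = bilinear_coeff P Q alpha tau m.
Proof.
  intros H; unfold bilinear_coeff; split.
  - intros E; rewrite E; field; exact H.
  - intros ->; field; exact H.
Qed.

(** With [v] written in [tau], the prefactor times the coefficient at [m - P + Q] gives the first
    and last ratios on the left; times the one at [m - P], the middle two. *)
Lemma ratio_equation_factor (P Q : Z) (alpha : C) (tau v : Z -> C)
    (htau : forall m : Z, tau m <> 0)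
    (hv : forall m : Z, v m = tau m / tau (m + Q)%Z) (m : Z) :
  v m / v (m + P)%Z - v (m - P)%Z / v m
    + alpha * (v (m + P - Q)%Z / v m - v m / v (m + Q - P)%Z)
  = tau m * tau (m + Q)%Z / (tau (m + P)%Z * tau (m - P + Q)%Z)
    * (bilinear_coeff P Q alpha tau (m - P + Q)
       - bilinear_coeff P Q alpha tau (m - P)).
Proof.
  unfold bilinear_coeff; rewrite !hv.
  (* [field] treats each value of [tau] as an atom, so equal indices must first be brought to the
     same form. *)
  replace (m + P - Q + Q)%Z with (m + P)%Z by lia.
  replace (m - P + Q + 2 * P)%Z with (m + P + Q)%Z by lia.
  replace (m + P + Q - Q)%Z with (m + P)%Z by lia.
  replace (m - P + Q + P)%Z with (m + Q)%Z by lia.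
  replace (m - P + 2 * P)%Z with (m + P)%Z by lia.
  replace (m - P + P)%Z with m by lia.
  replace (m + Q - P)%Z with (m - P + Q)%Z by lia.
  field; repeat split; apply htau.
Qed.

Lemma ratio_equation_iff_periodic (P Q : Z) (alpha : C) (tau v : Z -> C)
    (htau : forall m : Z, tau m <> 0)
    (hv : forall m : Z, v m = tau m / tau (m + Q)%Z) (m : Z) :
  v m / v (m + P)%Z - v (m - P)%Z / v m
    + alpha * (v (m + P - Q)%Z / v m - v m / v (m + Q - P)%Z) = 0
  <-> bilinear_coeff P Q alpha tau (m - P + Q)
      = bilinear_coeff P Q alpha tau (m - P).
Proof.
  rewrite (ratio_equation_factor P Q alpha tau v htau hv).
  set (b := bilinear_coeff P Q alpha tau).
  split.
  - intros E.
    (* The added term is the inverse of the nonzero prefactor times the product that [E] makes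
       zero. *)
    transitivity (b (m - P)%Z
      + tau (m + P)%Z * tau (m - P + Q)%Z / (tau m * tau (m + Q)%Z)
        * (tau m * tau (m + Q)%Z / (tau (m + P)%Z * tau (m - P + Q)%Z)
           * (b (m - P + Q)%Z - b (m - P)%Z))).
    + field; repeat split; apply htau.
    + rewrite E; ring.
  - intros ->; ring.
Qed.

Theorem proposition3p1 (P Q : Z) (hPQ : (Q < P)%Z) (alpha : C)
    (tau : Z -> C) (htau : forall m : Z, tau m <> 0)
    (v : Z -> C) (hv : forall m : Z, v m = tau m / tau (m + Q)%Z) :
  ((forall m : Z,
      v m / v (m + P)%Z - v (m - P)%Z / v m
        + alpha * (v (m + P - Q)%Z / v m - v m / v (m + Q - P)%Z) = 0) ->
   exists beta : Z -> C,
     (forall m : Z, beta (m + Q)%Z = beta m) /\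
     (forall m : Z,
        tau (m + 2 * P)%Z * tau m =
        alpha * tau (m + 2 * P - Q)%Z * tau (m + Q)%Z
          + beta m * (tau (m + P)%Z) ^ 2))
  /\
  (forall beta : Z -> C,
     (forall m : Z, beta (m + Q)%Z = beta m) ->
     (forall m : Z,
        tau (m + 2 * P)%Z * tau m =
        alpha * tau (m + 2 * P - Q)%Z * tau (m + Q)%Z
          + beta m * (tau (m + P)%Z) ^ 2) ->
     forall m : Z,
       v m / v (m + P)%Z - v (m - P)%Z / v m
         + alpha * (v (m + P - Q)%Z / v m - v m / v (m + Q - P)%Z) = 0).
Proof.
  split.
  - intros Hv; exists (bilinear_coeff P Q alpha tau); split; intros m.
    (* Shifting by [P] cancels the offset [m - P] of the criterion. *)
    + specialize (Hv (m + P)%Z).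
      apply (ratio_equation_iff_periodic P Q alpha tau v htau hv) in Hv.
      replace (m + P - P)%Z with m in Hv by lia; exact Hv.
    + apply bilinear_iff_coeff; [apply htau | reflexivity].
  - intros beta Hper Hbil m.
    (* The given [beta] is forced to be the explicit coefficient, so its period, taken at [m - P],
       carries over. *)
    assert (Hbeta : forall k, beta k = bilinear_coeff P Q alpha tau k)
      by (intros k; apply bilinear_iff_coeff; [apply htau | apply Hbil]).
    apply (ratio_equation_iff_periodic P Q alpha tau v htau hv).
    rewrite <- !Hbeta; apply Hper.
Qed.
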